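(* Let $\mathbb{K}$ be a non-Archimedean valued field with valuation $|\cdot|$, and let $n\in\mathbb{N}$. The following two statements are equivalent. (i) For every $A=[a_{j,k}]_{1\leq j\leq n,\,1\leq k\leq n}\in\mathbb{M}_n(\mathbb{K})$, $$\sigma(A)\subseteq \bigcup_{j,k=1,\ j\neq k}^n\{z\in\mathbb{K}: |z-a_{j,j}|\,|z-a_{k,k}|\leq v_j(A)v_k(A)\}.$$ (ii) Every $B=[b_{j,k}]_{1\leq j\leq n,\,1\leq k\leq n}\in\mathbb{M}_n(\mathbb{K})$ that satisfies $$|b_{j,j}|\,|b_{k,k}|>v_j(B)v_k(B)\quad\text{for all } 1\leq j,k\leq n,\ j\neq k,$$ is invertible.
   Context: A non-Archimedean valued field is a field $\mathbb{K}$ with a map $|\cdot|:\mathbb{K}\to[0,\infty)$ such that $|x|=0$ iff $x=0$, $|xy|=|x||y|$, and $|x+y|\leq\max\{|x|,|y|\}$ for all $x,y\in\mathbb{K}$. $\mathbb{N}$ is the set of positive integers and $\mathbb{M}_n(\mathbb{K})$ denotes the $n\times n$ matrices over $\mathbb{K}$. $\sigma(A)$ is the set of all eigenvalues of $A$ in $\mathbb{K}$, i.e. the $\lambda\in\mathbb{K}$ with $A\mathbf{x}=\lambda\mathbf{x}$ for some nonzero $\mathbf{x}\in\mathbb{K}^n$. For $A=[a_{j,k}]\in\mathbb{M}_n(\mathbb{K})$ and $1\leq k\leq n$, define $v_k(A)=\max_{1\leq j\leq n,\,j\neq k}|a_{j,k}|$, where a maximum over the empty set (occurring only when $n=1$)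 is $0$. *)

(* Defs.v *)
From mathcomp Require Import all_boot all_order all_algebra.
From mathcomp Require Import boolp classical_sets reals.

Set Implicit Arguments.
Unset Strict Implicit.
Unset Printing Implicit Defensive.

Import Order.TTheory GRing.Theory Num.Theory.
Local Open Scope classical_set_scope.
Local Open Scope ring_scope.

Record nonarchimedean_valuation (R : realType) (K : fieldType) (abs : K -> R)
    : Prop := NonarchimedeanValuation {
  nav_ge0 : forall x, 0 <= abs x;
  nav_eq0 : forall x, abs x = 0 <-> x = 0;
  nav_mul : forall x y, abs (x * y) = abs x * abs y;
  nav_ultra : forall x y, abs (x + y) <= Num.max (abs x) (abs y) }.

(* Eigenvectors are column vectors here; mxalgebra's [eigenvalue] is about the
   left action on row vectors. *)
Definition spectrum (K : fieldType) (n : nat) (A : 'M[K]_n) : set K :=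
  [set lambda | exists x : 'cV[K]_n, x <> 0 /\ A *m x = lambda *: x].

(* Column k without its diagonal entry. The base value 0 gives the convention
   for n = 1, and is otherwise harmless since a valuation is nonnegative. *)
Definition offdiag_max (R : realType) (K : fieldType) (abs : K -> R) (n : nat)
    (A : 'M[K]_n) (k : 'I_n) : R :=
  \big[Num.max/0]_(j < n | j != k) abs (A j k).

(* Main.v *)
Require Import Defs.
From mathcomp Require Import all_boot all_order all_algebra.
From mathcomp Require Import boolp classical_sets reals.

Set Implicit Arguments.
Unset Strict Implicit.
Unset Printing Implicit Defensive.

Import Order.TTheory GRing.Theory Num.Theory.
Local Open Scope classical_set_scope.
Local Open Scope ring_scope.

(** A point [z] is an eigenvalue of [A] exactly when [z%:M - A] is singular
    ([spectrumE]). Passing from [A] to [z%:M - A] replaces each diagonal entry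
    [A k k] by [z - A k k] and negates the other entries, which does not change
    their absolute values ([offdiag_max_scalarB]). So [z] lies outside every
    oval in (i) for [A] exactly when [z%:M - A] is dominant in the sense of (ii)
    ([notin_ovalsP]), and (i) for [A] and [z] is the contrapositive of (ii) for
    [B = z%:M - A]. Every [B] has this form, with [z = 0] and [A = - B], so
    neither statement is more general than the other. For [n = 1] there are no
    pairs [j != k], and both statements fail. *)

(** Both sides are nonnegative with the same square, as [(- x)^2 = x^2]. *)
Lemma abs_opp (R : realType) (K : fieldType) (abs : K -> R)
    (habs : nonarchimedean_valuation abs) (x : K) : abs (- x) = abs x.
Proof.
have [abs_ge0 _ absM _] := habs.
by apply/eqP; rewrite -(@eqrXn2 _ 2) // !expr2 -!absM mulrNN.
Qed.

(** [det0P] yields a row vector, so it is applied to the transpose. *)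
Lemma singular_colP (K : fieldType) (n : nat) (B : 'M[K]_n) :
  reflect (exists x : 'cV[K]_n, x <> 0 /\ B *m x = 0) (B \notin unitmx).
Proof.
rewrite unitmxE unitfE negbK -det_tr.
apply: (iffP det0P) => [[v /eqP v0 vB] | [x [/eqP x0 Bx]]].
  exists v^T; split; first by move/(congr1 trmx); rewrite trmxK trmx0.
  by rewrite -[B]trmxK -trmx_mul vB trmx0.
exists x^T; last by rewrite -trmx_mul Bx trmx0.
by apply: contraNneq x0 => /(congr1 trmx); rewrite trmxK trmx0 => ->.
Qed.

Lemma spectrumE (K : fieldType) (n : nat) (A : 'M[K]_n) (z : K) :
  spectrum A z <-> z%:M - A \notin unitmx.
Proof.
have eigE (x : 'cV[K]_n) : A *m x = z *: x <-> (z%:M - A) *m x = 0.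
  rewrite mulmxBl mul_scalar_mx.
  by split=> [-> | /eqP]; [rewrite subrr | rewrite subr_eq0 => /eqP].
split=> [[x [x0 /eigE Ax]] | /singular_colP [x [x0 /eigE Ax]]].
  by apply/singular_colP; exists x.
by exists x.
Qed.

Lemma offdiag_max_scalarB (R : realType) (K : fieldType) (abs : K -> R)
    (habs : nonarchimedean_valuation abs) (n : nat) (A : 'M[K]_n) (z : K)
    (k : 'I_n) :
  offdiag_max abs (z%:M - A) k = offdiag_max abs A k.
Proof.
apply: eq_bigr => j /negbTE jk.
by rewrite !mxE jk mulr0n add0r (abs_opp habs).
Qed.

(** The bridge between (i) and (ii). Absolute values are real, hence totally
    ordered, so the failure of a non-strict inequality is the opposite strict
    one; the ovals are then read off the entries of [z%:M - A]. *)
Lemma notin_ovalsP (R : realType) (K : fieldType) (abs : K -> R)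
    (habs : nonarchimedean_valuation abs) (n : nat) (A : 'M[K]_n) (z : K)
    (B := z%:M - A) :
  ~ (\bigcup_(p in [set p : 'I_n * 'I_n | p.1 != p.2])
       [set w : K | abs (w - A p.1 p.1) * abs (w - A p.2 p.2)
                    <= offdiag_max abs A p.1 * offdiag_max abs A p.2]) z
  <->
  (forall j k : 'I_n, j != k ->
     abs (B j j) * abs (B k k) > offdiag_max abs B j * offdiag_max abs B k).
Proof.
have diagB k : B k k = z - A k k by rewrite !mxE eqxx mulr1n.
split=> [out j k jk | dom [[j k] /= jk]].
  rewrite !diagB !offdiag_max_scalarB // ltNge.
  by apply/negP => zjk; apply: out; exists (j, k).
by have := dom j k jk; rewrite !diagB !offdiag_max_scalarB // ltNge => /negP.
Qed.

Theorem theorem2p8 (R : realType) (K : fieldType) (abs : K -> R)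
    (habs : nonarchimedean_valuation abs) (n : nat) (hn : (0 < n)%N) :
  (forall A : 'M[K]_n,
     spectrum A `<=`
       \bigcup_(p in [set p : 'I_n * 'I_n | p.1 != p.2])
         [set z : K | abs (z - A p.1 p.1) * abs (z - A p.2 p.2)
                      <= offdiag_max abs A p.1 * offdiag_max abs A p.2])
  <->
  (forall B : 'M[K]_n,
     (forall j k : 'I_n, j != k ->
        abs (B j j) * abs (B k k) > offdiag_max abs B j * offdiag_max abs B k) ->
     B \in unitmx).
Proof.
split=> [incl B domB | inv A z /spectrumE singA].
  have defB : B = 0%:M - - B by rewrite raddf0 sub0r opprK.
  apply: contrapT => /negP; rewrite defB => /spectrumE /incl.
  by apply/(notin_ovalsP habs); rewrite -defB.
apply: contrapT => /(notin_ovalsP habs) /inv unitA.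
by rewrite unitA in singA.
Qed.
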